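(* Let $M$ be a hyperkähler manifold with an $\mathcal{O}(2j-2)$-twisted rotational action relative to the 3-axis, with generators $\{X_n\}_{n=1-j,\dots,j-1}$. Then one can always redefine the generators $X_n$, by an allowed redefinition, so that they become sections of the bundle $T^{1,0}_{I_0}M$ if $n>0$ and of the bundle $T^{0,1}_{I_0}M$ if $n<0$.
   Context: A hyperkähler manifold is a smooth manifold $M$ of real dimension $4m$ with three symplectic forms $\omega_1,\omega_2,\omega_3$ such that, viewing 2-forms as bundle maps $TM\to T^*M$, the endomorphisms $I_1=\omega_3^{-1}\omega_2$, $I_2=\omega_1^{-1}\omega_3$, $I_3=\omega_2^{-1}\omega_1$ satisfy $I_1^2=I_2^2=I_3^2=I_1I_2I_3=-1$; the metric $g$ is given by $\omega_i(X,Y)=g(X,I_iY)$. Put $I_+=\tfrac12(I_1+iI_2)$, $I_0=I_3$, $I_-=-\tfrac12(I_1-iI_2)$, $\omega_+=\tfrac12(\omega_1+i\omega_2)$, $\omega_0=\omega_3$, $\omega_-=-\tfrac12(\omega_1-i\omega_2)$, and $\omega_n=0$ for $|n|>1$; for $\zeta\in\mathbb{C}^\times$: $I(\zeta)=\frac{I_+}{\zeta}+I_0+\zeta I_-$, $\omega(\zeta)=\frac{\omega_+}{\zeta}+\omega_0+\zeta\omega_-$. For an integer $j>1$ (the case $j=1$, a rotational Killing vector field, is allowed as a limit case), an $\mathcal{O}(2j-2)$-twisted rotational action relative to the 3-axis is generated by a system of $2j-1$ vector fields $X_n\in T_{\mathbb{C}}M$, $1-j\le n\le j-1$ (with $X_n=0$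 for other $n$), satisfying $\bar X_n=(-1)^nX_{-n}$ and $$\mathcal{L}_{X_{n-1}}\omega_++\mathcal{L}_{X_n}\omega_0+\mathcal{L}_{X_{n+1}}\omega_-=-i\,n\,\omega_n\quad\text{for all }n\in\mathbb{Z},$$ equivalently $\big(-i\zeta\frac{\partial}{\partial\zeta}+\mathcal{L}_{X(\zeta)}\big)\omega(\zeta)=0$ with $X(\zeta)=\sum_nX_n\zeta^{-n}$ and the Lie derivative taken on $M$ at fixed $\zeta$. An allowed redefinition is $X(\zeta)\mapsto X(\zeta)+I(\zeta)Y(\zeta)$ with $Y(\zeta)=\sum_{n=2-j}^{j-2}Y_n\zeta^{-n}$, i.e. $X_n\mapsto X_n+I_+Y_{n-1}+I_0Y_n+I_-Y_{n+1}$, where $Y_n\in T_{\mathbb{C}}M$ are arbitrary subject to $\bar Y_n=(-1)^nY_{-n}$ ($Y_n=0$ out of range); these leave $\iota_{X(\zeta)}\omega(\zeta)$ and the defining condition invariant. *)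

(* Defs.v *)
From HB Require Import structures.
From mathcomp Require Import all_boot all_order all_algebra.
From mathcomp Require Import complex ring.
From mathcomp Require Import all_classical all_reals all_analysis.

Set Implicit Arguments.
Unset Strict Implicit.
Unset Printing Implicit Defensive.

Import Order.TTheory GRing.Theory Num.Theory.
Import numFieldNormedType.Exports.
Local Open Scope classical_set_scope.
Local Open Scope ring_scope.

Section SmoothOn.
Context {R : realType} {n : nat}.
Implicit Types (V : set 'rV[R]_n) (f g : 'rV[R]_n -> R).

(* [V] is meant to be open; [f] is arbitrary outside of [V]. *)
Fixpoint Ck (k : nat) V f : Prop :=
  (forall x, V x -> {for x, continuous f}) /\
  if k is k'.+1 then
    forall i : 'I_n, (forall x, V x -> derivable f x (delta_mx 0 i)) /\
                     Ck k' V ('D_(delta_mx 0 i) f)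
  else True.

Definition smooth_on V f := forall k, Ck k V f.

Lemma Ck_ext k V f g : open V -> (forall x, V x -> f x = g x) ->
  Ck k V f -> Ck k V g.
Proof.
move=> oV; have nV (u w : 'rV[R]_n -> R) x : (forall x, V x -> u x = w x) ->
    V x -> \forall y \near x, u y = w y.
  by move=> uw Vx; apply: filterS (open_nbhs_nbhs (conj oV Vx)).
have cont (u w : 'rV[R]_n -> R) : (forall x, V x -> u x = w x) ->
    (forall x, V x -> {for x, continuous u}) ->
    forall x, V x -> {for x, continuous w}.
  move=> uw cu x Vx; rewrite /prop_for /continuous_at -(uw x Vx).
  apply: cvg_trans (cu x Vx).
  by apply: (@near_eq_cvg _ _ (nbhs x) _ u w); exact: (nV _ _ _ uw Vx).
elim: k f g => [|k IH] f g fg /= [cf df]; split=> //; try exact: cont fg cf.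
move=> i; have [dfi Cfi] := df i; split.
  move=> x Vx; apply: near_eq_derivable (dfi x Vx).
  exact: (nV _ _ _ fg Vx).
apply: IH Cfi => x Vx; apply: near_eq_derive.
exact: (nV _ _ _ fg Vx).
Qed.

Lemma Ck_le k V f : Ck k.+1 V f -> Ck k V f.
Proof.
elim: k f => [|k IH] f; first by case.
case=> cf df; split=> // i; have [dfi Cfi] := df i; split=> //.
exact: IH.
Qed.

Lemma Ck_cst k V (c : R) : Ck k V (cst c).
Proof.
elim: k c => [|k IH] c; split=> //; try by move=> x _; exact: cst_continuous.
move=> i; split=> [x _|]; first exact: derivable_cst.
rewrite (_ : 'D_(delta_mx 0 i) (cst c) = cst 0); first exact: IH.
by apply/funext => x; rewrite derive_cst.
Qed.

Lemma Ck_add k V f g : open V -> Ck k V f -> Ck k V g -> Ck k V (f + g).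
Proof.
move=> oV; elim: k f g => [|k IH] f g [cf df] [cg dg]; split=> //;
  try by move=> x Vx; apply: continuousD; [exact: cf|exact: cg].
move=> i; have [dfi Cfi] := df i; have [dgi Cgi] := dg i; split.
  by move=> x Vx; apply: derivableD; [exact: dfi|exact: dgi].
apply: Ck_ext (IH _ _ Cfi Cgi) => // x Vx.
by rewrite deriveD //; [exact: dfi|exact: dgi].
Qed.

Lemma Ck_mul k V f g : open V -> Ck k V f -> Ck k V g -> Ck k V (f * g).
Proof.
move=> oV; elim: k f g => [|k IH] f g Hf Hg; move: (Hf) (Hg);
  move=> [cf df] [cg dg]; split=> //;
  try by move=> x Vx; apply: continuousM; [exact: cf|exact: cg].
move=> i; have [dfi Cfi] := df i; have [dgi Cgi] := dg i; split.
  by move=> x Vx; apply: derivableM; [exact: dfi|exact: dgi].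
have := Ck_add oV (IH _ _ (Ck_le Hf) Cgi) (IH _ _ (Ck_le Hg) Cfi).
apply: Ck_ext => // x Vx.
by rewrite deriveM //; [exact: dfi|exact: dgi].
Qed.

End SmoothOn.

(* The maps are total; only their restrictions to the open sets [chart_dom] and
   [chart_im], on which they are mutually inverse homeomorphisms, matter. *)
Record chart (R : realType) (n : nat) (M : topologicalType) := Chart {
  chart_dom : set M ;
  chart_map : M -> 'rV[R]_n ;
  chart_inv : 'rV[R]_n -> M ;
  chart_dom_open : open chart_dom ;
  chart_im_open : open (chart_map @` chart_dom) ;
  chart_invK : forall p, chart_dom p -> chart_inv (chart_map p) = p ;
  chart_map_cont : forall p, chart_dom p -> {for p, continuous chart_map} ;
  chart_inv_cont : forall x, (chart_map @` chart_dom) x ->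
    {for x, continuous chart_inv} }.

Arguments chart_im_open {R n M} c.

Definition chart_im R n M (a : @chart R n M) := chart_map a @` chart_dom a.

Definition smoothly_compatible R n M (a b : @chart R n M) :=
  forall i : 'I_n, smooth_on (chart_map a @` (chart_dom a `&` chart_dom b))
                             (fun x => chart_map b (chart_inv a x) 0 i).

(* The atlas is not required to be maximal: the smooth structure is the one it
   generates. *)
Record manifold (R : realType) (n : nat) := Manifold {
  carrier :> topologicalType ;
  atlas : set (chart R n carrier) ;
  manifold_hausdorff : hausdorff_space carrier ;
  manifold_countable : @second_countable carrier ;
  atlas_cover : forall p : carrier, exists2 a, atlas a & chart_dom a p ;
  atlas_compat : forall a b, atlas a -> atlas b -> smoothly_compatible a b }.

Section SmoothFunctions.
Context {R : realType} {n : nat} (M : manifold R n).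

Definition is_smooth (f : M -> R) : Prop :=
  forall a, atlas a -> smooth_on (chart_im a) (f \o chart_inv a).

Definition smooth_pred : {pred M -> R} := [pred f | `[< is_smooth f >]].

Fact smooth_pred_subring : subring_closed smooth_pred.
Proof.
split=> [|f g /asboolP Hf /asboolP Hg|f g /asboolP Hf /asboolP Hg];
  apply/asboolP => a Aa k.
- exact: Ck_cst.
- have oV := chart_im_open a.
  have -> : (f - g) \o chart_inv a =
      f \o chart_inv a + cst (- 1) * (g \o chart_inv a).
    by apply/funext => x; rewrite !fctE /= mulN1r.
  by apply: Ck_add (Hf _ Aa k) (Ck_mul oV (Ck_cst _ _ _) (Hg _ Aa k)).
- exact: Ck_mul (chart_im_open a) (Hf _ Aa k) (Hg _ Aa k).
Qed.
HB.instance Definition _ :=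
  GRing.isSubringClosed.Build (M -> R) smooth_pred smooth_pred_subring.

Fact smooth_pred_scale : GRing.scaler_closed smooth_pred.
Proof.
move=> c f /asboolP Hf; apply/asboolP => a Aa k.
exact: Ck_mul (chart_im_open a) (Ck_cst k _ c) (Hf _ Aa k).
Qed.
HB.instance Definition _ :=
  GRing.isScaleClosed.Build R (M -> R) smooth_pred smooth_pred_scale.

Record Cinf := MkCinf { cinf_val :> M -> R ; _ : cinf_val \in smooth_pred }.

HB.instance Definition _ := [isSub for cinf_val].
HB.instance Definition _ := [Choice of Cinf by <:].
HB.instance Definition _ := GRing.SubChoice_isSubComPzRing.Build _ _ Cinf
  (subringClosedP smooth_pred).
HB.instance Definition _ := [SubZmodule_isSubLmodule of Cinf by <:].

Lemma is_smoothP (f : Cinf) : is_smooth f.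
Proof. by case: f => f Hf; exact/asboolP. Qed.

Definition mkCinf (f : M -> R) (Hf : is_smooth f) : Cinf :=
  MkCinf (introT (asboolP _) Hf).

Lemma cinf_ext (f g : Cinf) : (forall p, f p = g p) -> f = g.
Proof. by move=> fg; apply/val_inj/funext. Qed.

End SmoothFunctions.

Section Tangent.
Context {R : realType} {n : nat} {M : manifold R n}.

(* Tangent vectors at [p] are the derivations of the smooth functions at [p]. *)
Definition is_derivation (p : M) (v : Cinf M -> R) : Prop :=
  (forall (c : R) f g, v (c *: f + g) = c * v f + v g) /\
  (forall f g, v (f * g) = f p * v g + g p * v f).

Definition derivation_pred p : {pred Cinf M -> R} :=
  [pred v | `[< is_derivation p v >]].

Fact derivation_pred_submod p : GRing.submod_closed (derivation_pred p).
Proof.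
split=> [|c u v /asboolP[uL uM] /asboolP[vL vM]]; apply/asboolP; split.
- by move=> c f g; rewrite mulr0 addr0.
- by move=> f g; rewrite !mulr0 addr0.
- move=> d f g; rewrite !fctE uL vL !scalerDr /GRing.scale/= !mulrDr.
  by rewrite addrACA !(mulrCA c).
- move=> f g; rewrite !fctE uM vM !scalerDr /GRing.scale/= !mulrDr.
  by rewrite addrACA !(mulrCA c).
Qed.
HB.instance Definition _ p := GRing.isSubmodClosed.Build R (Cinf M -> R)
  (derivation_pred p) (derivation_pred_submod p).

Record tangent p := MkTangent {
  tangent_val :> Cinf M -> R ; _ : tangent_val \in derivation_pred p }.

HB.instance Definition _ p := [isSub for @tangent_val p].
HB.instance Definition _ p := [Choice of tangent p by <:].
HB.instance Definition _ p := [SubChoice_isSubLmodule of tangent p by <:].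

Lemma tangentP p (v : tangent p) : is_derivation p v.
Proof. by case: v => v Hv; exact/asboolP. Qed.

Definition mkTangent p v (Hv : is_derivation p v) : tangent p :=
  MkTangent (introT (asboolP _) Hv).

Lemma tangent_ext p (u v : tangent p) : (forall f, u f = v f) -> u = v.
Proof. by move=> uv; apply/val_inj/funext. Qed.

End Tangent.

Section VectorFields.
Context {R : realType} {n : nat} {M : manifold R n}.

(* A section of the tangent bundle is smooth iff it maps smooth functions to
   smooth functions; smoothness of the tensors below is likewise tested on smooth
   vector fields and functions. *)
Record vfield := MkVfield {
  vf_at :> forall p : M, tangent p ;
  vf_smooth : forall f : Cinf M, is_smooth (fun p => vf_at p f) }.

Lemma vfield_ext (X Y : vfield) : (forall p, X p = Y p) -> X = Y.
Proof.
case: X Y => [X HX] [Y HY] /= XY.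
have E : X = Y by apply: functional_extensionality_dep.
by case: _ / E HY => HY; congr MkVfield; exact: Prop_irrelevance.
Qed.

Definition act (X : vfield) (f : Cinf M) : Cinf M := mkCinf (vf_smooth X f).

Program Definition vf_zero := @MkVfield (fun p => 0) _.
Next Obligation. by move=> f; exact: (is_smoothP (0 : Cinf M)). Qed.
Program Definition vf_opp (X : vfield) := @MkVfield (fun p => - X p) _.
Next Obligation. by move=> X f; exact: (is_smoothP (- act X f)). Qed.
Program Definition vf_add (X Y : vfield) := @MkVfield (fun p => X p + Y p) _.
Next Obligation. by move=> X Y f; exact: (is_smoothP (act X f + act Y f)). Qed.
Program Definition vf_scale (c : R) (X : vfield) :=
  @MkVfield (fun p => c *: X p) _.
Next Obligation. by move=> c X f; exact: (is_smoothP (c *: act X f)). Qed.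

HB.instance Definition _ := gen_eqMixin vfield.
HB.instance Definition _ := gen_choiceMixin vfield.

Fact vf_addA : associative vf_add.
Proof. by move=> X Y Z; apply: vfield_ext => p; exact: addrA. Qed.
Fact vf_addC : commutative vf_add.
Proof. by move=> X Y; apply: vfield_ext => p; exact: addrC. Qed.
Fact vf_add0 : left_id vf_zero vf_add.
Proof. by move=> X; apply: vfield_ext => p; exact: add0r. Qed.
Fact vf_addN : left_inverse vf_zero vf_opp vf_add.
Proof. by move=> X; apply: vfield_ext => p; exact: addNr. Qed.
HB.instance Definition _ :=
  GRing.isZmodule.Build vfield vf_addA vf_addC vf_add0 vf_addN.

Fact vf_scaleA (a b : R) X : vf_scale a (vf_scale b X) = vf_scale (a * b) X.
Proof. by apply: vfield_ext => p; exact: scalerA. Qed.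
Fact vf_scale1 : left_id 1 vf_scale.
Proof. by move=> X; apply: vfield_ext => p; exact: scale1r. Qed.
Fact vf_scaleDr : right_distributive vf_scale +%R.
Proof. by move=> a X Y; apply: vfield_ext => p; exact: scalerDr. Qed.
Fact vf_scaleDl X : {morph vf_scale^~ X : a b / a + b}.
Proof. by move=> a b; apply: vfield_ext => p; exact: scalerDl. Qed.
HB.instance Definition _ := GRing.Zmodule_isLmodule.Build R vfield
  vf_scaleA vf_scale1 vf_scaleDr vf_scaleDl.

Fact bracket_derivation (X Y : vfield) p :
  is_derivation p (fun f => X p (act Y f) - Y p (act X f)).
Proof.
have actL (Z : vfield) c f g : act Z (c *: f + g) = c *: act Z f + act Z g.
  by apply: cinf_ext => q; exact: (tangentP (Z q)).1.
have actM (Z : vfield) f g : act Z (f * g) = f * act Z g + g * act Z f.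
  by apply: cinf_ext => q; exact: (tangentP (Z q)).2.
have vD q (v : tangent q) f g : v (f + g) = v f + v g.
  by have := (tangentP v).1 1 f g; rewrite scale1r mul1r.
split=> [c f g|f g].
- rewrite !actL !(tangentP _).1 mulrBr opprD.
  by rewrite -!addrA; congr (_ + _); rewrite addrCA.
- rewrite !actM !vD !(tangentP _).2 /=.
  by ring.
Qed.

Program Definition bracket (X Y : vfield) : vfield :=
  @MkVfield (fun p => mkTangent (bracket_derivation X Y p)) _.
Next Obligation.
by move=> X Y f; exact: (is_smoothP (act X (act Y f) - act Y (act X f))).
Qed.

End VectorFields.

Arguments vfield {R n} M.

Section Tensors.
Context {R : realType} {n : nat} {M : manifold R n}.

Record endo := MkEndo {
  endo_at :> forall p : M, tangent p -> tangent p ;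
  endo_linear : forall p : M, linear (@endo_at p) ;
  endo_smooth : forall (X : vfield M) (f : Cinf M),
    is_smooth (fun p => endo_at (X p) f) }.

Arguments endo_at : clear implicits.

Definition endo_app (I : endo) (X : vfield M) : vfield M :=
  @MkVfield _ _ _ (fun p => I p (X p)) (endo_smooth I X).

Record form2 := MkForm2 {
  form2_at :> forall p : M, tangent p -> tangent p -> R ;
  form2_linear : forall p (w : tangent p), scalar ((@form2_at p)^~ w) ;
  form2_skew : forall p (v w : tangent p), form2_at v w = - form2_at w v ;
  form2_smooth : forall X Y : vfield M,
    is_smooth (fun p => form2_at (X p) (Y p)) }.

Arguments form2_at : clear implicits.

Definition form2_app (w : form2) (X Y : vfield M) : Cinf M :=
  mkCinf (form2_smooth w X Y).

(* The exterior derivative, by the invariant formula. *)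
Definition dform2 (w : form2) (X Y Z : vfield M) : Cinf M :=
  act X (form2_app w Y Z) - act Y (form2_app w X Z) + act Z (form2_app w X Y)
  - form2_app w (bracket X Y) Z + form2_app w (bracket X Z) Y
  - form2_app w (bracket Y Z) X.

Record symplectic (w : form2) : Prop := Symplectic {
  symplectic_closed : forall X Y Z, dform2 w X Y Z = 0 ;
  symplectic_nondeg : forall p (v : tangent p),
    (forall u : tangent p, w p v u = 0) -> v = 0 }.

(* [I = b^-1 a] for 2-forms seen as the bundle maps [v |-> w(v, -)] from the
   tangent to the cotangent bundle; [I] is unique if [b] is nondegenerate. *)
Definition is_form2_ratio (I : endo) (b a : form2) : Prop :=
  forall p (v u : tangent p), b p (I p v) u = a p v u.

Lemma endoN (I : endo) p (v : tangent p) :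
  endo_at I p (- v) = - endo_at I p v.
Proof.
have L : linear (endo_at I p) := @endo_linear I p.
have L0 : endo_at I p 0 = 0.
  by have := L (- 1) 0 0; rewrite scaler0 add0r scaleN1r addNr.
by have := L (- 1) v 0; rewrite L0 !addr0 !scaleN1r.
Qed.

Lemma form2N (w : form2) p (v u : tangent p) :
  form2_at w p v (- u) = - form2_at w p v u.
Proof.
rewrite form2_skew [in RHS]form2_skew opprK.
have L : scalar ((form2_at w p)^~ v) := @form2_linear w p v.
have L0 : form2_at w p 0 v = 0.
  by have := L (- 1) 0 0; rewrite scaler0 add0r /= mulN1r addNr.
by have := L (- 1) u 0; rewrite /= L0 !addr0 scaleN1r mulN1r => ->; rewrite opprK.
Qed.

End Tensors.

Arguments endo {R n} M.
Arguments endo_at {R n M} e p v.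
Arguments form2_at {R n M} f p v w.
Arguments form2 {R n} M.

Record hyperkahler (R : realType) (m : nat) (M : manifold R (4 * m)) :=
  Hyperkahler {
  om1 : form2 M ;
  om2 : form2 M ;
  om3 : form2 M ;
  I1 : endo M ;
  I2 : endo M ;
  I3 : endo M ;
  om1_symplectic : symplectic om1 ;
  om2_symplectic : symplectic om2 ;
  om3_symplectic : symplectic om3 ;
  I1_def : is_form2_ratio I1 om3 om2 ;
  I2_def : is_form2_ratio I2 om1 om3 ;
  I3_def : is_form2_ratio I3 om2 om1 ;
  I1_sqr : forall p (v : tangent p), I1 p (I1 p v) = - v ;
  I2_sqr : forall p (v : tangent p), I2 p (I2 p v) = - v ;
  I3_sqr : forall p (v : tangent p), I3 p (I3 p v) = - v ;
  I123 : forall p (v : tangent p), I1 p (I2 p (I3 p v)) = - v }.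

(* The axioms make the metric symmetric and nondegenerate; they do not force it
   to be positive definite, and no result here needs that it is. *)
Definition hk_metric R m (M : manifold R (4 * m)) (H : hyperkahler M)
    (p : M) (v u : tangent p) : R := - om1 H p v (I1 H p u).

Section Metric.
Context {R : realType} {m : nat} {M : manifold R (4 * m)} (H : hyperkahler M).

Lemma hk_metricE p (v u : tangent p) :
  [/\ om1 H p v u = hk_metric H v (I1 H p u),
      om2 H p v u = hk_metric H v (I2 H p u) &
      om3 H p v u = hk_metric H v (I3 H p u)].
Proof.
have swap (I : endo M) (a b : form2 M) : is_form2_ratio I b a ->
    forall w z : tangent p, a p w z = b p w (I p z).
  by move=> E w z; rewrite form2_skew -E -form2_skew.
have E1 := swap _ _ _ (I1_def H); have E2 := swap _ _ _ (I2_def H).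
have E3 := swap _ _ _ (I3_def H).
have I12 w : I1 H p (I2 H p w) = I3 H p w.
  by have := I123 H (I3 H p w); rewrite I3_sqr !endoN => /oppr_inj.
split; rewrite /hk_metric.
- by rewrite I1_sqr form2N opprK.
- by rewrite I12 E3 I3_sqr form2N opprK.
- by rewrite -I12 I1_sqr form2N opprK E2.
Qed.

End Metric.

Section Complexification.
Context {R : rcfType}.

(* [Cx V] is V (x)_R C: the pair [(u, v)] stands for u + i v. *)
Record Cx (V : Type) := MkCx { cxRe : V ; cxIm : V }.

Lemma cx_ext V (z w : Cx V) : cxRe z = cxRe w -> cxIm z = cxIm w -> z = w.
Proof. by case: z w => [? ?] [? ?] /= -> ->. Qed.

HB.instance Definition _ V := gen_eqMixin (Cx V).
HB.instance Definition _ V := gen_choiceMixin (Cx V).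

Section Zmod.
Context {V : zmodType}.
Implicit Types z w : Cx V.

Definition cx_zero : Cx V := MkCx 0 0.
Definition cx_opp z := MkCx (- cxRe z) (- cxIm z).
Definition cx_add z w := MkCx (cxRe z + cxRe w) (cxIm z + cxIm w).

Fact cx_addA : associative cx_add.
Proof. by move=> x y z; apply: cx_ext; exact: addrA. Qed.
Fact cx_addC : commutative cx_add.
Proof. by move=> x y; apply: cx_ext; exact: addrC. Qed.
Fact cx_add0 : left_id cx_zero cx_add.
Proof. by move=> x; apply: cx_ext; exact: add0r. Qed.
Fact cx_addN : left_inverse cx_zero cx_opp cx_add.
Proof. by move=> x; apply: cx_ext; exact: addNr. Qed.
HB.instance Definition _ :=
  GRing.isZmodule.Build (Cx V) cx_addA cx_addC cx_add0 cx_addN.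

End Zmod.

Section Lmod.
Context {V : lmodType R}.
Implicit Types z w : Cx V.

Definition cx_scale (c : R[i]) z :=
  MkCx (complex.Re c *: cxRe z - complex.Im c *: cxIm z)
       (complex.Re c *: cxIm z + complex.Im c *: cxRe z).

Fact cx_scaleA (a b : R[i]) z : cx_scale a (cx_scale b z) = cx_scale (a * b) z.
Proof.
case: a b => [a1 a2] [b1 b2]; apply: cx_ext => /=;
  rewrite !scalerDr !scalerDl !scalerN !scaleNr !scalerA ?opprD;
  by rewrite (AC (2*2) ((1*4)*(2*3))).
Qed.
Fact cx_scale1 : left_id 1 cx_scale.
Proof.
move=> z; apply: cx_ext => /=; rewrite scale1r scale0r ?subr0 ?addr0 //.
Qed.
Fact cx_scaleDr : right_distributive cx_scale +%R.
Proof.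
move=> a z w; apply: cx_ext => /=; rewrite !scalerDr ?opprD; exact: addrACA.
Qed.
Fact cx_scaleDl z : {morph cx_scale^~ z : a b / a + b}.
Proof.
move=> [a1 a2] [b1 b2]; apply: cx_ext => /=;
  rewrite !scalerDl ?opprD; exact: addrACA.
Qed.
HB.instance Definition _ := GRing.Zmodule_isLmodule.Build R[i] (Cx V)
  cx_scaleA cx_scale1 cx_scaleDr cx_scaleDl.

End Lmod.

Definition cx_conj {V : zmodType} (z : Cx V) := MkCx (cxRe z) (- cxIm z).

(* Complexification of an R-linear map. *)
Definition cx_map {V W : Type} (h : V -> W) (z : Cx V) : Cx W :=
  MkCx (h (cxRe z)) (h (cxIm z)).

(* Complexification of an R-bilinear map. *)
Definition cx_map2 {U V : Type} {W : zmodType} (h : U -> V -> W)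
    (z : Cx U) (w : Cx V) : Cx W :=
  MkCx (h (cxRe z) (cxRe w) - h (cxIm z) (cxIm w))
       (h (cxRe z) (cxIm w) + h (cxIm z) (cxRe w)).

End Complexification.

Section ComplexCalculus.
Context {R : realType} {n : nat} {M : manifold R n}.

Definition cfun := Cx (Cinf M).
Definition cvfield := Cx (vfield M).
(* Complex 2-forms are represented by their values on complex vector fields. *)
Definition cform2 := cvfield -> cvfield -> cfun.

Definition cact : cvfield -> cfun -> cfun := cx_map2 act.
Definition cbracket : cvfield -> cvfield -> cvfield := cx_map2 bracket.
Definition cform2_of (w : form2 M) : cform2 := cx_map2 (form2_app w).
Definition cendo_of (I : endo M) : cvfield -> cvfield := cx_map (endo_app I).

Definition Lie (X : cvfield) (w : cform2) : cform2 := fun Y Z =>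
  cact X (w Y Z) - w (cbracket X Y) Z - w Y (cbracket X Z).

Definition cvf_at (Z : cvfield) (p : M) : Cx (tangent p) :=
  cx_map (fun X : vfield M => X p) Z.

Definition T10 (I : endo M) (p : M) : set (Cx (tangent p)) :=
  [set z | cx_map (I p) z = 'i%C *: z].
Definition T01 (I : endo M) (p : M) : set (Cx (tangent p)) :=
  [set z | cx_map (I p) z = - 'i%C *: z].

Definition section_of (E : forall p : M, set (Cx (tangent p))) (Z : cvfield) :=
  forall p, E p (cvf_at Z p).

End ComplexCalculus.

Arguments cfun {R n} M.
Arguments cvfield {R n} M.
Arguments cform2 {R n} M.

Section TwistedRotational.
Context {R : realType} {m : nat} {M : manifold R (4 * m)} (H : hyperkahler M).

Notation ii := ('i%C : R[i]).

Definition Iplus : cvfield M -> cvfield M :=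
  2^-1 *: (cendo_of (I1 H) + ii *: cendo_of (I2 H)).
Definition Izero : cvfield M -> cvfield M := cendo_of (I3 H).
Definition Iminus : cvfield M -> cvfield M :=
  - 2^-1 *: (cendo_of (I1 H) - ii *: cendo_of (I2 H)).

Definition omplus : cform2 M :=
  2^-1 *: (cform2_of (om1 H) + ii *: cform2_of (om2 H)).
Definition omzero : cform2 M := cform2_of (om3 H).
Definition omminus : cform2 M :=
  - 2^-1 *: (cform2_of (om1 H) - ii *: cform2_of (om2 H)).

Definition om_ (n : int) : cform2 M :=
  if n == 1 then omplus else if n == 0 then omzero
  else if n == -1 then omminus else 0.

(* Families of complex vector fields supported in [-k, k] and subject to the
   reality condition of a real section of O(2k); only 0 is such if k < 0. *)
Definition real_family (k : int) (X : int -> cvfield M) : Prop :=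
  (forall n, k < `|n| -> X n = 0) /\
  (forall n, cx_conj (X n) = ((-1) ^ n : R[i]) *: X (- n)).

Definition twisted_rotational (j : int) (X : int -> cvfield M) : Prop :=
  real_family (j - 1) X /\
  forall n, Lie (X (n - 1)) omplus + Lie (X n) omzero + Lie (X (n + 1)) omminus
            = (- ii * n%:~R) *: om_ n.

Definition redefinition (X Y : int -> cvfield M) (n : int) : cvfield M :=
  X n + Iplus (Y (n - 1)) + Izero (Y n) + Iminus (Y (n + 1)).

End TwistedRotational.

(* Main.v *)
Require Import Defs.
From HB Require Import structures.
From mathcomp Require Import all_boot all_order all_algebra.
From mathcomp Require Import complex ring zify.
From mathcomp Require Import all_classical all_reals all_analysis.

Set Implicit Arguments.
Unset Strict Implicit.
Unset Printing Implicit Defensive.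

Import Order.TTheory GRing.Theory Num.Theory.
Local Open Scope ring_scope.

(** Two independent facts make the theorem true.

    An allowed redefinition never spoils the defining condition.  By Cartan's
    formula, the Lie derivative of a closed 2-form w along X is the exterior
    derivative [dform1] of the 1-form w(X, -) ([Cartan_cform2_of], [CartanD],
    [CartanZ]), so the condition only sees the contraction of omega(zeta) with
    X(zeta).  The quaternion relations make I(zeta) square to zero and
    omega(zeta)(I(zeta) Y, -) vanish identically; comparing the coefficients of
    the powers of zeta, these are the five identities [omplus_Iplus] to
    [omminus_Iminus], and they give [contraction_redefinition].

    It remains to choose Y, which is linear algebra in the eigenspaces of I_0.
    On vectors of type (1,0) the operator I_+ is I_1 and I_- is zero; on vectors
    of type (0,1) the operator I_+ is zero; and I_1 exchanges the two types.
    For n > 0 the (0,1) part of X_n therefore disappears if the (1,0) part of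
    Y_(n-1) is I_1 (X_n)^(0,1), because I_+ maps this to - (X_n)^(0,1), provided
    that Y_n and Y_(n+1) have no (0,1) part: then I_0 Y_n is of type (1,0), and
    I_- Y_(n+1) is zero.  Hence Y_n for n > 0 is taken to be of type (1,0),
    namely I_1 (X_(n+1))^(0,1), and the values for n < 0 follow by conjugation.
    The two prescriptions overlap only at n = 0, where they concern the two
    different types and can be added ([corrector]).  The case n < 0 of the
    conclusion is the conjugate of the case n > 0. *)

(** * Complexification of real linear maps *)

Section ComplexifiedMaps.
Context {R : rcfType}.

Lemma cx_map_linear (V W : lmodType R) (h : V -> W) :
  linear h -> linear (cx_map h : Cx V -> Cx W).
Proof.
move=> hL.
pose h' : {linear V -> W} := HB.pack h (GRing.isLinear.Build _ _ _ _ h hL).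
move=> [a b] z w; apply: cx_ext; rewrite /= -[h]/(h' : V -> W);
  by rewrite !(linearD, linearN, linearZ).
Qed.

(** Complex linearity of a complexified bilinear map reduces to that of
    complexified linear maps: freeze one argument at its real and at its
    imaginary part. *)
Lemma cx_map2El (U V : Type) (W : lmodType R) (h : U -> V -> W) z w :
  cx_map2 h z w = cx_map (h^~ (cxRe w)) z + 'i%C *: cx_map (h^~ (cxIm w)) z.
Proof.
by apply: cx_ext => /=; rewrite scale0r scale1r ?sub0r ?add0r // addrC.
Qed.

Lemma cx_map2Er (U V : Type) (W : lmodType R) (h : U -> V -> W) z w :
  cx_map2 h z w = cx_map (h (cxRe z)) w + 'i%C *: cx_map (h (cxIm z)) w.
Proof. by apply: cx_ext => /=; rewrite scale0r scale1r ?sub0r ?add0r. Qed.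

Lemma cx_map2_linearl (U V W : lmodType R) (h : U -> V -> W) w :
  (forall v, linear (h^~ v)) -> linear ((cx_map2 h)^~ w : Cx U -> Cx W).
Proof.
move=> hL c z z'; rewrite !cx_map2El !(cx_map_linear (hL _)) !scalerDr.
by rewrite !scalerA (mulrC 'i%C) addrACA.
Qed.

Lemma cx_map2_linearr (U V W : lmodType R) (h : U -> V -> W) z :
  (forall u, linear (h u)) -> linear (cx_map2 h z : Cx V -> Cx W).
Proof.
move=> hL c w w'; rewrite !cx_map2Er !(cx_map_linear (hL _)) !scalerDr.
by rewrite !scalerA (mulrC 'i%C) addrACA.
Qed.

Lemma cx_conjD (V : zmodType) (z w : Cx V) :
  cx_conj (z + w) = cx_conj z + cx_conj w.
Proof. by apply: cx_ext => //=; rewrite opprD. Qed.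

Lemma cx_conjN (V : zmodType) (z : Cx V) : cx_conj (- z) = - cx_conj z.
Proof. exact: cx_ext. Qed.

Lemma cx_conjK (V : zmodType) (z : Cx V) : cx_conj (cx_conj z) = z.
Proof. by apply: cx_ext => //=; rewrite opprK. Qed.

Lemma cx_conjZ (V : lmodType R) (c : R[i]) (z : Cx V) :
  cx_conj (c *: z) = conjc c *: cx_conj z.
Proof.
case: c => a b; apply: cx_ext => /=; rewrite ?scalerN ?scaleNr ?opprK //.
by rewrite opprD.
Qed.

Lemma cx_conj_map (V W : lmodType R) (h : V -> W) z :
  linear h -> cx_conj (cx_map h z) = cx_map h (cx_conj z).
Proof.
move=> hL.
pose h' : {linear V -> W} := HB.pack h (GRing.isLinear.Build _ _ _ _ h hL).
by apply: cx_ext; rewrite //= -[h]/(h' : V -> W) linearN.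
Qed.

End ComplexifiedMaps.

(** * Cartan's formula for complex forms *)

Section CartanFormula.
Context {R : realType} {n : nat} {M : manifold R n}.
Implicit Types (X Y Z : vfield M) (w : form2 M).

Lemma act_linear X : linear (act X).
Proof. by move=> c f g; apply: cinf_ext => p; exact: (tangentP (X p)).1. Qed.

Lemma form2_app_linear w Y : linear ((form2_app w)^~ Y).
Proof. by move=> c X Z; apply: cinf_ext => p; exact: form2_linear. Qed.

Lemma form2_app_skew w X Y : form2_app w X Y = - form2_app w Y X.
Proof. by apply: cinf_ext => p; exact: form2_skew. Qed.

Lemma endo_app_linear (I : endo M) : linear (endo_app I).
Proof. by move=> c X Y; apply: vfield_ext => p; exact: endo_linear. Qed.

HB.instance Definition _ X :=
  GRing.isLinear.Build _ _ _ _ (act X) (act_linear X).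

HB.instance Definition _ (I : endo M) :=
  GRing.isLinear.Build _ _ _ _ (cendo_of I)
    (cx_map_linear (@endo_app_linear I)).

Lemma cform2_of_linear w : linear (cform2_of w).
Proof.
by move=> c X Z; apply/funext => Y; exact/cx_map2_linearl/form2_app_linear.
Qed.

HB.instance Definition _ w :=
  GRing.isLinear.Build _ _ _ _ (cform2_of w) (@cform2_of_linear w).

HB.instance Definition _ (X : cvfield M) :=
  GRing.isLinear.Build _ _ _ _ (cact X) (cx_map2_linearr X act_linear).

(** The exterior derivative of a complex 1-form, by the invariant formula. *)
Definition dform1 (a : cvfield M -> cfun M) : cform2 M :=
  fun Y Z : cvfield M =>
  cact Y (a Z) - cact Z (a Y) - a (cbracket Y Z).

Lemma dform1_linear : linear dform1.
Proof.
move=> c a b; apply/funext => Y; apply/funext => Z.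
rewrite /dform1 !fctE !(linearP (cact _)) /= !opprD !scalerBr.
by rewrite [LHS](AC ((2*2)*2) ((1*3*5)*(2*4*6))).
Qed.

HB.instance Definition _ :=
  GRing.isLinear.Build _ _ _ _ dform1 dform1_linear.

(** Closedness of w in the form that turns the derivative along X, the first term
    of a Lie derivative, into terms that contain X only as an argument of w or
    in the brackets cancelled by the rest of the Lie derivative. *)
Lemma act_form2_app w X Y Z : symplectic w ->
  act X (form2_app w Y Z) =
    form2_app w (bracket X Y) Z + form2_app w Y (bracket X Z)
    + act Y (form2_app w X Z) - act Z (form2_app w X Y)
    - form2_app w X (bracket Y Z).
Proof.
move=> /symplectic_closed /(_ X Y Z); rewrite /dform2.
rewrite (form2_app_skew _ (bracket X Z)) (form2_app_skew _ (bracket Y Z)).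
move=> dw0.
by apply/eqP; rewrite -subr_eq0 -dw0; apply/eqP; ring.
Qed.

Lemma form2_app_linearr w X : linear (form2_app w X).
Proof.
move=> c Y Z; rewrite !(form2_app_skew w X) form2_app_linear.
by rewrite opprD scalerN.
Qed.

HB.instance Definition _ w X :=
  GRing.isLinear.Build _ _ _ _ (form2_app w X) (@form2_app_linearr w X).

Lemma form2_appBl w X Y Z : form2_app w (X - Y) Z =
  form2_app w X Z - form2_app w Y Z.
Proof. by rewrite form2_app_skew linearB opprB addrC -!form2_app_skew. Qed.

Lemma form2_appDl w X Y Z : form2_app w (X + Y) Z =
  form2_app w X Z + form2_app w Y Z.
Proof. by rewrite form2_app_skew linearD opprD -!form2_app_skew. Qed.

(** The property L_V w = d (w(V, -)), which for 2-forms expresses closedness. *)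
Definition Cartan (w : cform2 M) := forall V, Lie V w = dform1 (w V).

(** Cartan's formula without its term in dw.  Expanding both sides into real and
    imaginary parts leaves four instances of the real formula in each part. *)
Lemma Cartan_cform2_of w : symplectic w -> Cartan (cform2_of w).
Proof.
move=> sw X; apply/funext => Y; apply/funext => Z.
apply: cx_ext; rewrite /= !form2_appBl !form2_appDl !linearB !linearD /=;
  rewrite !(act_form2_app (cxRe X) _ _ sw) !(act_form2_app (cxIm X) _ _ sw);
  ring.
Qed.

Lemma dform1D (a b : cvfield M -> cfun M) :
  dform1 (a + b) = dform1 a + dform1 b.
Proof. exact: linearD. Qed.

Lemma dform1Z (c : R[i]) (a : cvfield M -> cfun M) :
  dform1 (c *: a) = c *: dform1 a.
Proof. exact: linearZ. Qed.

Lemma CartanD (w w' : cform2 M) : Cartan w -> Cartan w' -> Cartan (w + w').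
Proof.
move=> wC wC' V; transitivity (Lie V w + Lie V w'); last first.
  by rewrite wC wC'; exact/esym/dform1D.
apply/funext => Y; apply/funext => Z; rewrite /Lie !fctE linearD /= !opprD.
by rewrite [LHS](AC ((2*2)*2) ((1*3*5)*(2*4*6))).
Qed.

Lemma CartanZ (c : R[i]) (w : cform2 M) : Cartan w -> Cartan (c *: w).
Proof.
move=> wC V; transitivity (c *: Lie V w); last first.
  by rewrite wC; exact/esym/dform1Z.
apply/funext => Y; apply/funext => Z.
by rewrite /Lie !fctE linearZ /= !scalerBr.
Qed.

End CartanFormula.

(** * Contraction of omega(zeta) with I(zeta) Y *)

Section Quaternions.
Context {R : realType} {m : nat} {M : manifold R (4 * m)} (H : hyperkahler M).

Notation ii := ('i%C : R[i]).
Notation K1 := (cendo_of (I1 H)).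
Notation K2 := (cendo_of (I2 H)).
Notation K3 := (cendo_of (I3 H)).
Notation w1 := (cform2_of (om1 H)).
Notation w2 := (cform2_of (om2 H)).
Notation w3 := (cform2_of (om3 H)).
Implicit Types V : cvfield M.

Lemma sqri : ii * ii = -1.
Proof. by rewrite -expr2 sqr_i. Qed.

Lemma cendo_ofN (I J : endo M) :
  (forall p (v : tangent p), I p (J p v) = - v) ->
  forall V, cendo_of I (cendo_of J V) = - V.
Proof. by move=> IJ V; apply: cx_ext; apply: vfield_ext => p; exact: IJ. Qed.

Let K1K1 V : K1 (K1 V) = - V. Proof. exact/cendo_ofN/I1_sqr. Qed.
Let K2K2 V : K2 (K2 V) = - V. Proof. exact/cendo_ofN/I2_sqr. Qed.
Let K3K3 V : K3 (K3 V) = - V. Proof. exact/cendo_ofN/I3_sqr. Qed.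

Lemma K1K2 V : K1 (K2 V) = K3 V.
Proof.
have K123 : K1 (K2 (K3 (K3 V))) = - K3 V.
  by apply: cx_ext; apply: vfield_ext => p; exact: I123.
by apply: oppr_inj; rewrite -K123 K3K3 !linearN.
Qed.

Lemma K1K3 V : K1 (K3 V) = - K2 V.
Proof. by rewrite -K1K2 K1K1. Qed.

Lemma K3K2 V : K3 (K2 V) = - K1 V.
Proof. by rewrite -K1K2 K2K2 linearN. Qed.

Lemma K3K1 V : K3 (K1 V) = K2 V.
Proof.
have -> : K1 V = - K3 (K2 V) by rewrite K3K2 opprK.
by rewrite linearN /= K3K3 opprK.
Qed.

Lemma cform2_of_ratio (I : endo M) (b a : form2 M) V : is_form2_ratio I b a ->
  cform2_of b (cendo_of I V) = cform2_of a V.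
Proof.
by move=> E; apply/funext => U; apply: cx_ext; apply: cinf_ext => p /=;
  rewrite !fctE /= !E.
Qed.

Let w3K1 V : w3 (K1 V) = w2 V. Proof. exact/cform2_of_ratio/I1_def. Qed.
Let w1K2 V : w1 (K2 V) = w3 V. Proof. exact/cform2_of_ratio/I2_def. Qed.
Let w2K3 V : w2 (K3 V) = w1 V. Proof. exact/cform2_of_ratio/I3_def. Qed.

Let w2K1 V : w2 (K1 V) = - w3 V.
Proof. by rewrite -w3K1 K1K1 linearN. Qed.
Let w3K2 V : w3 (K2 V) = - w1 V.
Proof. by rewrite -w1K2 K2K2 linearN. Qed.
Let w1K3 V : w1 (K3 V) = - w2 V.
Proof. by rewrite -w2K3 K3K3 linearN. Qed.
Let w1K1 V : w1 (K1 V) = w3 (K3 V).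
Proof. by rewrite -K1K2 w3K1 -w2K3 K3K1. Qed.
Let w2K2 V : w2 (K2 V) = w3 (K3 V).
Proof. by rewrite -K1K2 w3K1. Qed.

(** With c = i or c = -i, the next three lemmas treat the combinations
    w_1 + c w_2 and I_1 + c I_2 underlying omega_+, omega_-, I_+ and I_- at
    once: the sign of i agrees in form and operator, or one of the two is taken
    on the third axis, or the signs are opposite.  They hold because all three
    forms w_k (I_k V, -) agree, while w_a (I_b V, -) is plus or minus the
    remaining form for a different from b. *)
Lemma contraction_same (c : R[i]) V : c * c = -1 ->
  w1 (K1 V + c *: K2 V) + c *: w2 (K1 V + c *: K2 V) = 0.
Proof.
move=> c2; rewrite !linearD !linearZ /= w1K1 w2K2 w1K2 w2K1.
by rewrite scalerA c2 scalerN scaleN1r -opprD [X in _ - X]addrC subrr.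
Qed.

Lemma contraction_axis (c : R[i]) V :
  w1 (K3 V) + c *: w2 (K3 V) + w3 (K1 V + c *: K2 V) = 0.
Proof.
rewrite linearD linearZ /= w1K3 w2K3 w3K1 w3K2 scalerN.
by rewrite addrACA addNr subrr addr0.
Qed.

Lemma contraction_opposite (c : R[i]) V : c * c = -1 ->
  w1 (K1 V + (- c) *: K2 V) + c *: w2 (K1 V + (- c) *: K2 V)
    = w3 (K3 V) - c *: w3 V + (w3 (K3 V) - c *: w3 V).
Proof.
move=> c2; rewrite scaleNr !linearB !linearZ /= w1K1 w2K2 w1K2 w2K1.
by rewrite !scalerN scalerA c2 scaleN1r opprK; rewrite [X in _ + X = _]addrC.
Qed.

Lemma IplusE V : Iplus H V = 2^-1 *: (K1 V + ii *: K2 V).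
Proof. by []. Qed.

Lemma IminusE V : Iminus H V = - 2^-1 *: (K1 V + (- ii) *: K2 V).
Proof. by rewrite (scaleNr ii). Qed.

Lemma omplusE V : omplus H V = 2^-1 *: (w1 V + ii *: w2 V).
Proof. by []. Qed.

Lemma omminusE V : omminus H V = - 2^-1 *: (w1 V + (- ii) *: w2 V).
Proof. by rewrite (scaleNr ii). Qed.

Lemma linear_combination_linear (U W : lmodType R[i]) (f g : {linear U -> W})
    (a b : R[i]) :
  linear (fun x => a *: (f x + b *: g x)).
Proof.
move=> c x y; rewrite (linearP f) (linearP g) /= [b *: (_ + _)]scalerDr addrACA.
rewrite [LHS]scalerDr; congr (_ + _).
by rewrite !scalerDr !scalerA [a * c]mulrC -!mulrA [b * c]mulrC mulrCA.
Qed.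

Lemma Iplus_linear : linear (Iplus H).
Proof. by move=> c U V; rewrite !IplusE linear_combination_linear. Qed.

Lemma Iminus_linear : linear (Iminus H).
Proof. by move=> c U V; rewrite !IminusE linear_combination_linear. Qed.

Lemma omplus_linear : linear (omplus H).
Proof. by move=> c U V; rewrite !omplusE linear_combination_linear. Qed.

Lemma omminus_linear : linear (omminus H).
Proof. by move=> c U V; rewrite !omminusE linear_combination_linear. Qed.

HB.instance Definition _ :=
  GRing.isLinear.Build _ _ _ _ (Iplus H) Iplus_linear.
HB.instance Definition _ :=
  GRing.isLinear.Build _ _ _ _ (Iminus H) Iminus_linear.
HB.instance Definition _ :=
  GRing.isLinear.Build _ _ _ _ (Izero H)
    (cx_map_linear (@endo_app_linear _ _ _ (I3 H))).
HB.instance Definition _ :=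
  GRing.isLinear.Build _ _ _ _ (omplus H) omplus_linear.
HB.instance Definition _ :=
  GRing.isLinear.Build _ _ _ _ (omzero H) (cform2_of_linear (om3 H)).
HB.instance Definition _ :=
  GRing.isLinear.Build _ _ _ _ (omminus H) omminus_linear.

Lemma sqrNi : (- ii) * (- ii) = -1.
Proof. by rewrite mulrNN sqri. Qed.

Lemma omplus_Iplus V : omplus H (Iplus H V) = 0.
Proof.
by rewrite IplusE linearZ /= omplusE contraction_same ?sqri // !scaler0.
Qed.

Lemma omminus_Iminus V : omminus H (Iminus H V) = 0.
Proof.
by rewrite IminusE linearZ /= omminusE contraction_same ?sqrNi // !scaler0.
Qed.

Lemma omplus_Izero V : omplus H (Izero H V) + omzero H (Iplus H V) = 0.
Proof.
by rewrite omplusE IplusE linearZ /= -scalerDr contraction_axis scaler0.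
Qed.

Lemma omminus_Izero V : omminus H (Izero H V) + omzero H (Iminus H V) = 0.
Proof.
by rewrite omminusE IminusE linearZ /= -scalerDr contraction_axis scaler0.
Qed.

Lemma half_double (W : lmodType R[i]) (x : W) : 2^-1 *: (x + x) = x.
Proof.
by rewrite -mulr2n -scalerMnr -scaler_nat scalerA divff ?scale1r // pnatr_eq0.
Qed.

Lemma omplus_Iminus V :
  omplus H (Iminus H V) + omzero H (Izero H V) + omminus H (Iplus H V) = 0.
Proof.
rewrite IminusE IplusE !linearZ /= omplusE omminusE.
rewrite contraction_opposite ?sqri //.
have := contraction_opposite V sqrNi; rewrite opprK => ->.
rewrite !(scaleNr 2^-1) !scalerN !half_double !scaleNr opprK.
by rewrite addrAC -opprD -scalerDr addrACA addNr addr0 half_double addNr.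
Qed.

(** The coefficients of omega(zeta)(I(zeta) Y, -) vanish, so the redefinition
    leaves the coefficients of omega(zeta)(X(zeta), -) unchanged. *)
Lemma contraction_redefinition (X Y : int -> cvfield M) (n : int) :
  let X' := redefinition H X Y in
  omplus H (X' (n - 1)) + omzero H (X' n) + omminus H (X' (n + 1))
  = omplus H (X (n - 1)) + omzero H (X n) + omminus H (X (n + 1)).
Proof.
rewrite /= /redefinition !(linearD (omplus H)) !(linearD (omzero H)).
rewrite !(linearD (omminus H)) /=.
rewrite subrK addrK omplus_Iplus omminus_Iminus !addr0.
(* Group the terms that contain Y by Y (n - 1), Y n and Y (n + 1). *)
rewrite [LHS](AC (3*4*3) ((1*4*8)*(2*5)*(3*6*9)*(10*7))).
rewrite -[RHS]addr0 -[RHS]addr0 -[RHS]addr0.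
congr (_ + _ + _ + _).
- exact: omplus_Izero.
- exact: omplus_Iminus.
- exact: omminus_Izero.
Qed.

Lemma Cartan_om12 a (b : R[i]) : Cartan (a *: (w1 + b *: w2)).
Proof.
apply/CartanZ/CartanD; first exact/Cartan_cform2_of/om1_symplectic.
exact/CartanZ/Cartan_cform2_of/om2_symplectic.
Qed.

Lemma Cartan_omplus : Cartan (omplus H).
Proof. exact: Cartan_om12. Qed.

Lemma Cartan_omminus : Cartan (omminus H).
Proof. by rewrite /omminus -(scaleNr ii); exact: Cartan_om12. Qed.

Lemma Cartan_omzero : Cartan (omzero H).
Proof. exact/Cartan_cform2_of/om3_symplectic. Qed.

(** * Types with respect to the third complex structure *)

(** The projection onto the c-eigenspace of I_0, for c a square root of -1. *)
Definition eigenproj (c : R[i]) V := 2^-1 *: (V - c *: K3 V).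

Lemma eigenproj_linear c : linear (eigenproj c).
Proof.
move=> d U V; rewrite /eigenproj -!scaleNr.
exact: (linear_combination_linear idfun (cendo_of (I3 H))).
Qed.

HB.instance Definition _ c :=
  GRing.isLinear.Build _ _ _ _ (eigenproj c) (eigenproj_linear c).

Lemma K3_eigenproj (c : R[i]) V :
  c * c = -1 -> K3 (eigenproj c V) = c *: eigenproj c V.
Proof.
move=> c2; rewrite /eigenproj linearZ /= linearB linearZ /= K3K3.
rewrite scalerN opprK scalerA mulrC -scalerA; congr (_ *: _).
by rewrite scalerBr scalerA c2 scaleN1r opprK addrC.
Qed.

Lemma eigenprojD (c : R[i]) V : eigenproj c V + eigenproj (- c) V = V.
Proof.
by rewrite /eigenproj scaleNr opprK -scalerDr addrACA addNr addr0 half_double.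
Qed.

(** I_1 anticommutes with I_0, hence exchanges its eigenspaces. *)
Lemma K3K1_eigen V (c : R[i]) : K3 V = c *: V -> K3 (K1 V) = - c *: K1 V.
Proof.
by move=> KV; rewrite K3K1 -[LHS]opprK -K1K3 KV linearZ /= scaleNr.
Qed.

Lemma K2_eigen V (c : R[i]) : K3 V = c *: V -> K2 V = - c *: K1 V.
Proof. by move/K3K1_eigen; rewrite K3K1. Qed.

Lemma Iplus10 V : K3 V = ii *: V -> Iplus H V = K1 V.
Proof.
move=> /K2_eigen K2V; rewrite IplusE K2V scalerA mulrN sqri opprK scale1r.
exact: half_double.
Qed.

Lemma Iplus01 V : K3 V = - ii *: V -> Iplus H V = 0.
Proof.
move=> /K2_eigen K2V; rewrite IplusE K2V scalerA opprK sqri scaleN1r.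
by rewrite subrr scaler0.
Qed.

Lemma Iminus10 V : K3 V = ii *: V -> Iminus H V = 0.
Proof.
move=> /K2_eigen K2V; rewrite IminusE K2V scalerA sqrNi scaleN1r.
by rewrite subrr scaler0.
Qed.

Lemma eigenfield_at V (c : R[i]) (p : M) : K3 V = c *: V ->
  cx_map (I3 H p) (cvf_at V p) = c *: cvf_at V p.
Proof.
move=> KV; apply: cx_ext.
  exact: (congr1 (fun Z : cvfield M => cxRe Z p) KV).
exact: (congr1 (fun Z : cvfield M => cxIm Z p) KV).
Qed.

Lemma cx_conj_cendo (I : endo M) V :
  cx_conj (cendo_of I V) = cendo_of I (cx_conj V).
Proof. exact/cx_conj_map/endo_app_linear. Qed.

Lemma conjc_i : conjc ii = - ii.
Proof. by apply/eqP; rewrite eq_complex /= oppr0 !eqxx. Qed.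

Lemma conjc_half : conjc (2^-1 : R[i]) = 2^-1.
Proof. by rewrite fmorphV rmorph_nat. Qed.

Lemma cx_conj_eigenproj (c : R[i]) V :
  cx_conj (eigenproj c V) = eigenproj (conjc c) (cx_conj V).
Proof.
by rewrite cx_conjZ conjc_half cx_conjD cx_conjN cx_conjZ cx_conj_cendo.
Qed.

Lemma cx_conj_Iplus V : cx_conj (Iplus H V) = - Iminus H (cx_conj V).
Proof.
rewrite IplusE IminusE cx_conjZ conjc_half cx_conjD cx_conjZ conjc_i.
by rewrite !cx_conj_cendo (scaleNr 2^-1) opprK.
Qed.

Lemma cx_conj_Iminus V : cx_conj (Iminus H V) = - Iplus H (cx_conj V).
Proof.
by rewrite -[Iplus H _]cx_conjK cx_conj_Iplus cx_conjN opprK cx_conjK.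
Qed.

Lemma Lie_redefinition (X Y : int -> cvfield M) (n : int) :
  let X' := redefinition H X Y in
  Lie (X' (n - 1)) (omplus H) + Lie (X' n) (omzero H)
    + Lie (X' (n + 1)) (omminus H)
  = Lie (X (n - 1)) (omplus H) + Lie (X n) (omzero H)
    + Lie (X (n + 1)) (omminus H).
Proof.
rewrite /= !Cartan_omplus !Cartan_omzero !Cartan_omminus.
have dD (a b c : cvfield M -> cfun M) :
    dform1 a + dform1 b + dform1 c = dform1 (a + b + c) by rewrite !dform1D.
rewrite [LHS]dD [RHS]dD; congr dform1; exact: contraction_redefinition.
Qed.

Lemma signr_succ (n : int) : (-1 : R[i]) ^ (n + 1) = - (-1) ^ n.
Proof. by rewrite expfzDr ?oppr_eq0 ?oner_eq0 // expr1z mulrN1. Qed.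

Lemma signr_pred (n : int) : (-1 : R[i]) ^ (n - 1) = - (-1) ^ n.
Proof. by rewrite expfzDr ?oppr_eq0 ?oner_eq0 // exprN1 invrN1 mulrN1. Qed.

Lemma redefinition_real (k : int) (X Y : int -> cvfield M) :
  real_family k X -> real_family (k - 1) Y ->
  real_family k (redefinition H X Y).
Proof.
move=> [X0 Xc] [Y0 Yc]; split=> n.
  by move=> kn; rewrite /redefinition X0 // !Y0 ?linear0 ?addr0 //; lia.
rewrite /redefinition !cx_conjD Xc cx_conj_Iplus cx_conj_Iminus.
rewrite cx_conj_cendo !Yc.
have IpZ c V : Iplus H (c *: V) = c *: Iplus H V by exact: linearZ.
have ImZ c V : Iminus H (c *: V) = c *: Iminus H V by exact: linearZ.
have K3Z c V : K3 (c *: V) = c *: K3 V by exact: linearZ.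
rewrite signr_succ signr_pred IpZ ImZ K3Z !scaleNr !opprK !scalerDr.
rewrite opprB opprD [1 - n]addrC.
by rewrite [LHS](AC 4 (1*4*3*2)).
Qed.

End Quaternions.

(** * The correcting redefinition *)

Section Corrector.
Context {R : realType} {m : nat} {M : manifold R (4 * m)} (H : hyperkahler M).
Context (X : int -> cvfield M).

Notation ii := ('i%C : R[i]).
Notation K1 := (cendo_of (I1 H)).
Notation K3 := (cendo_of (I3 H)).

(** The (1,0) and (0,1) parts of the correction; their signs are forced by
    I_+ = I_1 on type (1,0) and I_- = - I_1 on type (0,1). *)
Definition corrector10 n :=
  if 0 <= n then K1 (eigenproj H (- ii) (X (n + 1))) else 0.
Definition corrector01 n :=
  if n <= 0 then - K1 (eigenproj H ii (X (n - 1))) else 0.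
Definition corrector n := corrector10 n + corrector01 n.

Lemma K3_corrector10 n : K3 (corrector10 n) = ii *: corrector10 n.
Proof.
rewrite /corrector10; case: ifP => _; last by rewrite linear0 scaler0.
by rewrite (K3K1_eigen (K3_eigenproj H _ sqrNi)) opprK.
Qed.

Lemma K3_corrector01 n : K3 (corrector01 n) = - ii *: corrector01 n.
Proof.
rewrite /corrector01; case: ifP => _; last by rewrite linear0 scaler0.
by rewrite linearN /= (K3K1_eigen (K3_eigenproj H _ sqri)) scalerN.
Qed.

Lemma corrector_real (k : int) :
  real_family k X -> real_family (k - 1) corrector.
Proof.
move=> [X0 Xc]; split=> n.
  move=> kn; rewrite /corrector /corrector10 /corrector01.
  do 2 case: ifP => ?;
  by rewrite ?(X0 (n + 1)) ?(X0 (n - 1)) ?linear0 ?oppr0 ?addr0 //; lia.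
have KPZ c a V : K1 (eigenproj H c (a *: V)) = a *: K1 (eigenproj H c V).
  transitivity (K1 (a *: eigenproj H c V)); last exact: linearZ.
  by congr K1; exact: linearZ.
have conj0 : cx_conj 0 = 0 :> cvfield M by apply: cx_ext => //=; rewrite oppr0.
have conj10 : cx_conj (corrector10 n) = (-1) ^ n *: corrector01 (- n).
  rewrite /corrector10 /corrector01 oppr_le0.
  case: ifP => _; last by rewrite conj0 scaler0.
  rewrite cx_conj_cendo cx_conj_eigenproj -conjc_i conjcK Xc KPZ.
  by rewrite signr_succ opprD scaleNr scalerN.
have conj01 : cx_conj (corrector01 n) = (-1) ^ n *: corrector10 (- n).
  rewrite /corrector10 /corrector01 oppr_ge0.
  case: ifP => _; last by rewrite conj0 scaler0.
  rewrite cx_conjN cx_conj_cendo cx_conj_eigenproj conjc_i Xc KPZ.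
  by rewrite signr_pred opprB [1 - n]addrC scaleNr opprK.
by rewrite cx_conjD conj10 conj01 addrC -scalerDr.
Qed.

(** For n > 0 the corrected generator is the (1,0) part of X_n plus I_0 Y_n. *)
Lemma redefinition_corrector10 n : 0 < n ->
  K3 (redefinition H X corrector n) = ii *: redefinition H X corrector n.
Proof.
move=> n0.
have corr0 k : 0 < k -> corrector01 k = 0.
  by move=> k0; rewrite /corrector01 leNgt k0.
have -> : redefinition H X corrector n =
    eigenproj H ii (X n) + ii *: corrector10 n.
  rewrite /redefinition /corrector (corr0 n) // (corr0 (n + 1)); last by lia.
  rewrite !addr0 (Iminus10 (K3_corrector10 _)) addr0 /Izero K3_corrector10.
  congr (_ + _).
  (* At n = 1, Y_(n-1) = Y_0 also has a (0,1) part, but I_+ kills it. *)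
  rewrite linearD /= (Iplus01 (K3_corrector01 _)) addr0.
  rewrite (Iplus10 (K3_corrector10 _)) /corrector10 ifT; last by lia.
  rewrite subrK cendo_ofN; last exact: I1_sqr.
  by rewrite -{1}(eigenprojD H ii (X n)) addrK.
have K3P c U V : K3 (c *: U + V) = c *: K3 U + K3 V by exact: linearP.
by rewrite addrC K3P K3_eigenproj ?sqri // K3_corrector10 scalerDr.
Qed.

End Corrector.

Theorem lemma26 (R : realType) (m : nat) (M : manifold R (4 * m))
    (H : hyperkahler M) (j : int) (hj : 1 <= j) (X : int -> cvfield M)
    (hX : twisted_rotational H j X) :
  exists Y : int -> cvfield M,
    [/\ real_family (j - 2) Y,
        twisted_rotational H j (redefinition H X Y),
        forall n : int, 0 < n ->
          section_of (T10 (I3 H)) (redefinition H X Y n) &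
        forall n : int, n < 0 ->
          section_of (T01 (I3 H)) (redefinition H X Y n)].
Proof.
have [Xreal Xrot] := hX; exists (corrector H X).
have Yreal : real_family (j - 1 - 1) (corrector H X) by exact: corrector_real.
have X'real := redefinition_real H Xreal Yreal.
split.
- by have -> : j - 2 = j - 1 - 1 by lia.
- by split=> // n; rewrite Lie_redefinition Xrot.
- by move=> n n0 p; apply/eigenfield_at/redefinition_corrector10.
- move=> n n0 p; apply: eigenfield_at.
  (* X'_n is conjugate to X'_(- n) up to sign, and conjugation swaps types. *)
  rewrite -(cx_conjK (redefinition _ _ _ n)) X'real.2 -cx_conj_cendo.
  have K3Z c V : cendo_of (I3 H) (c *: V) = c *: cendo_of (I3 H) V.
    by exact: linearZ.
  rewrite K3Z redefinition_corrector10 ?oppr_gt0 // scalerA mulrC -scalerA.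
  by rewrite cx_conjZ conjc_i.
Qed.
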